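(* Let $K$ be a differential field whose underlying field is perfect, let $F$ be a differential field extension of $K$, and let $y\in F$ be nonzero. If $y'/y$ is algebraic over $K$, then both $y$ and $1/y$ satisfy linear differential equations over $K$; that is, there exist nonzero homogeneous linear differential polynomials $L_1(Y),L_2(Y)$ with coefficients in $K$ such that $L_1(y)=0$ and $L_2(1/y)=0$.
   Context: A differential field is a field with a single derivation, written $u\mapsto u'$; a differential field extension $F$ of $K$ is a field extension with a derivation on $F$ extending that of $K$. A field $K$ is perfect if every irreducible polynomial in $K[x]$ has distinct roots. A nonzero homogeneous linear differential polynomial over $K$ is an expression $L(Y)=c_NY^{(N)}+\cdots+c_1Y'+c_0Y$ with $c_i\in K$ not all zero, where $Y^{(k)}$ denotes the $k$-th derivative. *)

(* Defs.v *)
From HB Require Import structures.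
From mathcomp Require Import all_boot all_order all_algebra all_field.

Set Implicit Arguments.
Unset Strict Implicit.
Unset Printing Implicit Defensive.

Import GRing.Theory.
Local Open Scope ring_scope.

HB.mixin Record hasDerivation F of GRing.Field F := {
  der : F -> F;
  derD : forall u v : F, der (u + v) = der u + der v;
  derM : forall u v : F, der (u * v) = der u * v + u * der v
}.

#[short(type="diffFieldType")]
HB.structure Definition DiffField := {F of GRing.Field F & hasDerivation F}.

(* An extension is given by its embedding, not by an inclusion of carriers. *)
Definition diff_extension (K F : diffFieldType) (iota : {rmorphism K -> F}) :=
  forall a : K, iota (der a) = der (iota a).

(* The sequence s lists the roots of p with multiplicity, in any finite
   extension L of K over which p splits. *)
Definition has_distinct_roots (K : fieldType) (p : {poly K}) :=
  forall (L : fieldExtType K) (s : seq L),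
    map_poly (in_alg L) p %= \prod_(a <- s) ('X - a%:P) -> uniq s.

Definition perfect_field (K : fieldType) :=
  forall p : {poly K}, irreducible_poly p -> has_distinct_roots p.

(* The value at z of L(Y) = c_N Y^(N) + ... + c_1 Y' + c_0 Y. *)
Definition ldiff_eval (K F : diffFieldType) (iota : {rmorphism K -> F})
    (N : nat) (c : 'I_N.+1 -> K) (z : F) : F :=
  \sum_(k < N.+1) iota (c k) * iter k der z.

Definition satisfies_ldiff_eq (K F : diffFieldType)
    (iota : {rmorphism K -> F}) (z : F) :=
  exists (N : nat) (c : 'I_N.+1 -> K),
    (exists k, c k != 0) /\ ldiff_eval iota c z = 0.

(* Main.v *)
Require Import Defs.
From mathcomp Require Import all_boot all_order all_algebra all_field.
From Stdlib Require Import Classical_Prop.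

(** Write u for y'/y. Every derivative of y has the form q(u) y with q a
    polynomial over K, as soon as u' itself is a polynomial in u
    ([iter_der_logder]). Since u is a root of a nonzero p over K, each q can be
    replaced by its remainder modulo p, so y, y', ..., y^(d) with d = deg p all
    lie in a space spanned over K by the d elements u^i y; a linear dependence
    between them is the equation sought ([ldiff_eq_of_logder]).

    That u' is a polynomial in u is where perfectness enters
    ([der_algebraic]). Choose p irreducible. Differentiating p(u) = 0 gives
    r(u) + p^`()(u) u' = 0 for some r over K, where p^`() is the formal
    derivative. If p^`() is nonzero it is coprime to p, and a Bezout relation
    inverts p^`()(u) inside K[u]. To see that p^`() is nonzero one needs to
    know that p really has distinct roots; as that condition speaks of
    extensions in which p splits, such an extension has to be built
    ([splitting_extension]): were p^`() zero, each root there would be a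
    multiple one ([perfect_deriv_neq0]).

    The case of 1/y follows from that of y, because its logarithmic derivative
    is -u. *)

Set Implicit Arguments.
Unset Strict Implicit.
Unset Printing Implicit Defensive.

Import GRing.Theory.
Local Open Scope ring_scope.

(** * Irreducible polynomials *)

(** A polynomial satisfying P is either irreducible or a product of two smaller
    ones, one of which inherits P, so descending on the size terminates at an
    irreducible polynomial. The predicate P stands for being a nonconstant
    divisor of a fixed polynomial, or a nonzero polynomial vanishing at a fixed
    point. Irreducibility over an abstract field is not decidable, whence the
    excluded middle. *)
Lemma irreducible_of_prime_pred (K : fieldType) (P : {poly K} -> Prop) :
    (forall q, P q -> (1 < size q)%N) ->
    (forall q r, P (q * r) -> P q \/ P r) ->
  forall p, P p -> exists2 q, irreducible_poly q & P q.
Proof.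
move=> Psize Pprime p.
have [n] := ubnP (size p); elim: n p => // n IHn p /ltnSE le_p_n Pp.
have p_gt1 := Psize p Pp.
have p_neq0 : p != 0 by rewrite -size_poly_gt0 ltnW.
have [[d [d_neq1 [dvd_dp neq_dp]]]|no_div] :=
  classic (exists d : {poly K}, size d != 1 /\ (d %| p /\ ~ d %= p));
  last first.
  exists p => //; split=> // d d_neq1 dvd_dp; apply/idP/negPn/negP=> neq_dp.
  by case: no_div; exists d; split=> //; split=> //; apply/negP.
have lt_dp : (size d < size p)%N.
  rewrite ltn_neqAle dvdp_leq // andbT; apply/negP => eq_dp.
  by apply: neq_dp; rewrite -dvdp_size_eqp.
have d_neq0 : d != 0 by apply: dvdpN0 dvd_dp p_neq0.
have d_gt1 : (1 < size d)%N.
  by rewrite ltn_neqAle eq_sym d_neq1 size_poly_gt0.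
pose e := p %/ d; have Ep : p = e * d by rewrite divpK.
have lt_ep : (size e < size p)%N.
  rewrite size_divp // ltn_subrL (ltnW p_gt1) andbT.
  by rewrite -subn1 subn_gt0.
have := Pp; rewrite Ep => /Pprime[].
  exact: IHn (leq_trans lt_ep le_p_n).
exact: IHn (leq_trans lt_dp le_p_n).
Qed.

Lemma irreducible_divisor (K : fieldType) (p : {poly K}) :
  (1 < size p)%N -> exists2 q, irreducible_poly q & q %| p.
Proof.
move=> p_gt1; pose P (q : {poly K}) := (1 < size q)%N /\ q %| p.
have Pp : P p by split.
have [||q irr_q [_ q_p]] := @irreducible_of_prime_pred K P _ _ p Pp.
- by move=> q [].
- move=> q r [qr_gt1 qr_p].
  have q_p : q %| p by apply: dvdp_trans qr_p; apply: dvdp_mulr.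
  have r_p : r %| p by apply: dvdp_trans qr_p; apply: dvdp_mull.
  have [q_le1|q_gt1] := leqP (size q) 1; last by left.
  have [r_le1|r_gt1] := leqP (size r) 1; last by right.
  have := leq_trans qr_gt1 (size_polyMleq q r).
  by case: (size q) q_le1 => [|[|]] // _; case: (size r) r_le1 => [|[|]].
by exists q.
Qed.

Lemma irreducible_annihilator (K F : fieldType) (iota : {rmorphism K -> F})
    (u : F) :
  algebraicOver iota u ->
  exists2 p, irreducible_poly p & root (map_poly iota p) u.
Proof.
case=> p p_neq0 pu; pose P (q : {poly K}) := q != 0 /\ root (map_poly iota q) u.
have Pp : P p by split.
have [||q irr_q [_ qu]] := @irreducible_of_prime_pred K P _ _ p Pp.
- move=> q [q_neq0 qu]; rewrite -(size_map_poly iota).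
  by apply: root_size_gt1 qu; rewrite map_poly_eq0.
- move=> q r [qr_neq0]; rewrite rmorphM rootM.
  have [q_neq0 r_neq0] : q != 0 /\ r != 0.
    by apply/andP; rewrite -negb_or -mulf_eq0.
  by case/orP; [left | right].
by exists q.
Qed.

(** * Splitting extensions and perfect fields *)

(** Adjoin one root, divide it out, and continue over the larger field; the
    tower is then read as an extension of the bottom field through
    [baseFieldType], whose structure map is the composite of the two. *)
Lemma splitting_extension (K : fieldType) (p : {poly K}) :
  p != 0 -> exists (L : fieldExtType K) (s : seq L),
    map_poly (in_alg L) p %= \prod_(a <- s) ('X - a%:P).
Proof.
have [n] := ubnP (size p); elim: n => // n IHn in K p * => /ltnSE le_p_n p_neq0.
have [p_le1|p_gt1] := leqP (size p) 1.
  exists (K^o : fieldExtType K), [::]; rewrite big_nil -size_poly_eq1.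
  by rewrite size_map_poly eqn_leq p_le1 size_poly_gt0.
have [q irr_q dvd_qp] := irreducible_divisor p_gt1.
have [L _ [z qz _]] := irredp_FAdjoin irr_q.
have : root (map_poly (in_alg L) p) z.
  by move: qz; rewrite -!dvdp_XsubCl => /dvdp_trans; apply; rewrite dvdp_map.
case/factor_theorem=> r Ep.
have pL_neq0 : map_poly (in_alg L) p != 0 by rewrite map_poly_eq0.
have r_neq0 : r != 0 by apply: contraNneq pL_neq0 => r0; rewrite Ep r0 mul0r.
have lt_rn : (size r < n)%N.
  apply: leq_trans le_p_n; rewrite -(size_map_poly (in_alg L) p) Ep.
  by rewrite size_mul ?polyXsubC_eq0 // size_XsubC addn2.
have [M [s Er]] := IHn L r lt_rn r_neq0.
exists (baseFieldType M : fieldExtType K), (in_alg M z :: s).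
have -> : map_poly (in_alg (baseFieldType M)) p
        = map_poly (in_alg M) (map_poly (in_alg L) p) :> {poly M}.
  rewrite -map_poly_comp; apply: eq_map_poly => a /=.
  by rewrite baseField_scaleE.
rewrite Ep rmorphM /= map_polyXsubC big_cons mulrC.
by apply: eqp_mull.
Qed.

(** If the derivative vanished, then at a root a in a splitting extension,
    where p = (X - a) r, the product rule would give r(a) = 0, so that a
    would be a second time among the roots. *)
Lemma perfect_deriv_neq0 (K : fieldType) (p : {poly K}) :
  perfect_field K -> irreducible_poly p -> p^`() != 0.
Proof.
move=> perfK irr_p; apply/negP=> /eqP p'0.
have p_neq0 := irredp_neq0 irr_p.
have [L [s Ep]] := splitting_extension p_neq0.
have := perfK p irr_p L s Ep.
have pL_size := size_map_poly (in_alg L) p.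
have pL'0 : (map_poly (in_alg L) p)^`() = 0 by rewrite deriv_map p'0 rmorph0.
have /eqpP[[c d] /= /andP[_ d_neq0] Ecd] := Ep.
case: s Ep Ecd => [Ep _|a s Ep].
  move/eqp_size: Ep; rewrite big_nil size_poly1 pL_size => p1.
  by case: irr_p; rewrite p1.
(* Differentiate c p = d (X - a) prod_(b <- s) (X - b) and evaluate at a. *)
rewrite big_cons => /(congr1 (fun q => q^`().[a])).
rewrite !derivZ pL'0 scaler0 horner0 hornerZ derivM derivXsubC mul1r.
rewrite hornerD hornerM hornerXsubC subrr mul0r addr0 => /esym/eqP.
rewrite mulf_eq0 (negPf d_neq0) /= => sa.
by rewrite -root_prod_XsubC /root sa.
Qed.

(** * Derivatives of algebraic elements *)

Lemma der0 (F : diffFieldType) : der (0 : F) = 0.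
Proof. by apply: (@addrI _ (der 0)); rewrite -derD !addr0. Qed.

Lemma der1 (F : diffFieldType) : der (1 : F) = 0.
Proof.
by apply: (@addrI _ (der 1)); rewrite addr0 -[in RHS](mul1r 1) derM mulr1 mul1r.
Qed.

(** The polynomial r below arises from q by differentiating its
    coefficients. *)
Lemma der_horner (K F : diffFieldType) (iota : {rmorphism K -> F})
    (u : F) (q : {poly K}) :
  diff_extension iota ->
  exists r : {poly K}, der (map_poly iota q).[u]
    = (map_poly iota r).[u] + (map_poly iota q^`()).[u] * der u.
Proof.
move=> iota_der; elim/poly_ind: q => [|q c [r Er]].
  by exists 0; rewrite deriv0 !rmorph0 horner0 der0 mul0r addr0.
exists (r * 'X + (der c)%:P).
rewrite derivD derivM derivX derivC addr0 mulr1.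
rewrite !(rmorphD, rmorphM) /= !map_polyX !map_polyC /=.
rewrite !(hornerD, hornerM, hornerX, hornerC) derD derM Er iota_der.
by rewrite !mulrDl mulrAC [RHS]addrAC !addrA.
Qed.

(** Differentiating p(u) = 0 for an irreducible p determines u' up to the factor
    p^`()(u); perfectness makes p^`() coprime to p, so that the Bezout
    coefficient of p^`(), taken at u, is the inverse of that factor. *)
Lemma der_algebraic (K F : diffFieldType) (iota : {rmorphism K -> F})
    (u : F) :
  perfect_field K -> diff_extension iota -> algebraicOver iota u ->
  exists g : {poly K}, der u = (map_poly iota g).[u].
Proof.
move=> perfK iota_der /irreducible_annihilator[p irr_p /rootP pu].
have p'_neq0 := perfect_deriv_neq0 perfK irr_p.
have : coprimep p p^`().
  rewrite irreducible_poly_coprime //; apply/negP=> /(dvdp_leq p'_neq0).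
  by rewrite leqNgt lt_size_deriv ?irredp_neq0.
case/Bezout_eq1_coprimepP=> -[a b] /= Eab.
have [r] := der_horner u p iota_der; rewrite pu der0 => Er.
have Eb : (map_poly iota b).[u] * (map_poly iota p^`()).[u] = 1.
  have := congr1 (fun q => (map_poly iota q).[u]) Eab.
  rewrite rmorphD !rmorphM rmorph1 /= hornerD !hornerM pu mulr0 add0r.
  by rewrite hornerC.
exists (- (b * r)); rewrite rmorphN rmorphM hornerN hornerM.
rewrite -[LHS]mul1r -Eb -mulrA -mulrN; congr (_ * _).
by apply/eqP; rewrite -addr_eq0 addrC -Er.
Qed.

(** * The linear differential equation *)

(** For u = y'/y one has (q(u) y)' = (q(u)' + q(u) u) y, and q(u)' is again a
    polynomial in u once u' is one. *)
Lemma iter_der_logder (K F : diffFieldType) (iota : {rmorphism K -> F})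
    (y : F) (g : {poly K}) :
  diff_extension iota -> y != 0 ->
  der (der y / y) = (map_poly iota g).[der y / y] ->
  forall k, exists q : {poly K},
    iter k der y = (map_poly iota q).[der y / y] * y.
Proof.
move=> iota_der y_neq0; set u := der y / y => Eu.
have Ey : der y = u * y by rewrite divfK.
elim=> [|k [q Eq]]; first by exists 1; rewrite rmorph1 hornerC mul1r.
have [r Er] := der_horner u q iota_der.
exists (r + q^`() * g + q * 'X).
rewrite iterS Eq derM Er Eu Ey !(rmorphD, rmorphM) /= map_polyX.
by rewrite !(hornerD, hornerM, hornerX) mulrA -mulrDl.
Qed.

(** The coefficients form a matrix with one more row than it has columns, so
    some nonzero row vector annihilates it on the left. *)
Lemma poly_linear_dependence (K : fieldType) (n : nat)
    (q : 'I_n.+1 -> {poly K}) :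
  (forall k, (size (q k) <= n)%N) ->
  exists2 c : 'I_n.+1 -> K, exists k, c k != 0 & \sum_k c k *: q k = 0.
Proof.
move=> q_size; pose A := \matrix_(k < n.+1) (poly_rV (q k) : 'rV_n).
have : kermx A != 0.
  by rewrite kermx_eq0 -row_leq_rank -ltnNge ltnS rank_leq_col.
case/rowV0Pn=> v /sub_kermxP vA v_neq0; exists (v 0).
  by have /rV0Pn := v_neq0.
transitivity (rVpoly (v *m A)); last by rewrite vA linear0.
rewrite mulmx_sum_row linear_sum; apply: eq_bigr => k _.
by rewrite linearZ rowK /= poly_rV_K.
Qed.

(** Reducing modulo an annihilator p of u = y'/y does not change the values at
    u, and it confines the n + 1 polynomials representing y, y', ..., y^(n)
    to the n-dimensional space of remainders, n being the degree of p. *)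
Lemma ldiff_eq_of_logder (K F : diffFieldType) (iota : {rmorphism K -> F})
    (y : F) :
  perfect_field K -> diff_extension iota -> y != 0 ->
  algebraicOver iota (der y / y) -> satisfies_ldiff_eq iota y.
Proof.
move=> perfK iota_der y_neq0 u_alg; have [p p_neq0 /rootP pu] := u_alg.
have [g Eu] := der_algebraic perfK iota_der u_alg.
have iter_y := iter_der_logder iota_der y_neq0 Eu.
move: pu iter_y; set u := der y / y => pu iter_y.
pose n := (size p).-1.
have [q Eq] := @fin_all_exists 'I_n.+1 _ _ (fun k => iter_y k).
have [|c c_neq0 Ec] := @poly_linear_dependence K n (fun k => q k %% p).
  by move=> k; rewrite -ltnS prednK ?size_poly_gt0 // ltn_modp.
exists n, c; split=> //; rewrite /ldiff_eval.
transitivity ((map_poly iota (\sum_k c k *: (q k %% p))).[u] * y); last first.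
  by rewrite Ec rmorph0 horner0 mul0r.
rewrite rmorph_sum horner_sum mulr_suml; apply: eq_bigr => k _.
rewrite /= map_polyZ hornerZ Eq -mulrA; congr (_ * (_ * _)).
rewrite {1}(divp_eq (q k) p) rmorphD rmorphM hornerD hornerM pu mulr0.
by rewrite add0r.
Qed.

(** The Leibniz rule applied to y (1/y) = 1. *)
Lemma logderV (F : diffFieldType) (y : F) :
  y != 0 -> der y^-1 / y^-1 = - (der y / y).
Proof.
move=> y_neq0; rewrite invrK; apply/eqP; rewrite -addr_eq0 addrC.
by rewrite [X in _ + X]mulrC -derM divff // der1.
Qed.

Theorem proposition1p3 (K F : diffFieldType) (iota : {rmorphism K -> F})
  (hK : perfect_field K) (hF : diff_extension iota)
  (y : F) (hy : y != 0) (halg : algebraicOver iota (der y / y)) :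
  satisfies_ldiff_eq iota y /\ satisfies_ldiff_eq iota (y^-1).
Proof.
split; apply: ldiff_eq_of_logder => //; first by rewrite invr_eq0.
by rewrite logderV //; apply: algebraic_opp.
Qed.
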